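(* Let $S$ be a strictly increasing sequence of positive integers of zero density that is universally $L^1$-good. Then for any unbounded $\phi:\mathbb{R}\to\mathbb{R}^+$ that satisfies $\phi(x)=1$ for $x\le 1$ and is strictly increasing on $[1,\infty)$, there exists a perturbation $\Delta$ of $S$ that is universally $L\phi(L)$-good but universally $\infty$-sweeping out in $L^1$.
   Context: All sequences are strictly increasing sequences of positive integers, identified with their sets of values. For a set of integers $A$, $|A|$ is its cardinality and $A(N)=A\cap[1,N)$. A sequence $S$ has zero density if $|S(N)|/N\to 0$ as $N\to\infty$. A sequence $\Delta$ is a perturbation of $S$ iff $\lim_{N\to\infty}\frac{|\{(\Delta\setminus S)\cup(S\setminus\Delta)\}(N)|}{|S(N)|}=0$. All measure-preserving systems $(X,\Sigma,m,T)$ are on probability spaces and are aperiodic (free): for every $n\ge1$ the set $\{x: T^n x=x\}$ has measure zero. For a probability space $(X,\Sigma,m)$, $L\phi(L)=\left\{f:X\to\mathbb{R}\text{ measurable}: \int_X |f|\,\phi(|f|)\,dm<\infty\right\}$. Let $F$ denote a function space (such as $L^1$ or $L\phi(L)$) defined on each probability space, and let $S=\{a_1<a_2<\cdots\}$. Then $S$ is universally $F$-good iff, for all aperiodic measure-preserving systems $(X,\Sigma,m,T)$ on probability spaces and every $f\in F$, the averages $\frac1N\sum_{n=1}^N f(T^{a_n}x)$ converge (to a finite limit) for a.e. $x$ as $N\to\infty$. $S$ is universally $\infty$-sweeping out in $F$ if for all aperiodic measure-preserving systems $(X,\Sigma,m,T)$ on probability spaces there exists $f\in F$ such that $\sup_N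 \frac1N\sum_{n=1}^N f(T^{a_n}x)=\infty$ for almost every $x$.
   Formalization: Probability spaces are required to have countably many measurable sets separating points off a null set (as all standard spaces do); otherwise the shift on the integers with the trivial sigma-algebra is aperiodic but admits no sweeping out. *)

(* Defs.v *)
From HB Require Import structures.
From mathcomp Require Import all_boot all_order all_algebra.
From mathcomp Require Import finmap.
From mathcomp Require Import all_classical all_reals all_analysis.

Set Implicit Arguments.
Unset Strict Implicit.
Unset Printing Implicit Defensive.

Import Order.TTheory GRing.Theory Num.Theory.
Import numFieldNormedType.Exports.

Local Open Scope classical_set_scope.
Local Open Scope ring_scope.

(* A sequence a_1 < a_2 < ... is given by a : nat -> nat, with a n standing
   for a_(n+1); its set of values is [range a]. *)
Definition increasing_pos_seq (a : nat -> nat) : Prop :=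
  (0 < a 0)%N /\ {homo a : m n / (m < n)%N}.

(* The cardinality of A(N) = A `&` [1, N). *)
Definition count_below (A : set nat) (N : nat) : nat :=
  #|` fset_set (A `&` [set n | (1 <= n < N)%N]) |%fset.

Definition zero_density (R : realType) (A : set nat) : Prop :=
  (fun N : nat => (count_below A N)%:R / N%:R : R) @ \oo --> (0 : R).

Definition perturbation (R : realType) (D S : set nat) : Prop :=
  (fun N : nat => (count_below ((D `\` S) `|` (S `\` D)) N)%:R
                  / (count_below S N)%:R : R) @ \oo --> (0 : R).

Definition measure_preserving (R : realType) d (X : measurableType d)
    (m : probability X R) (T : X -> X) : Prop :=
  measurable_fun setT T /\
  forall A : set X, measurable A -> m (T @^-1` A) = m A.

Definition aperiodic (R : realType) d (X : measurableType d)
    (m : probability X R) (T : X -> X) : Prop :=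
  forall n : nat, (1 <= n)%N -> m.-negligible [set x | iter n T x = x].

(* Off a null set, points are separated by countably many measurable sets.
   Every standard (Lebesgue) probability space has this property.  Without it
   aperiodicity says nothing about measurable sets: the shift of the integers
   with the trivial sigma-algebra has no periodic point, but all its measurable
   functions are constant. *)
Definition countably_separated (R : realType) d (X : measurableType d)
    (m : probability X R) : Prop :=
  exists (A : nat -> set X) (Z : set X),
    [/\ forall i, measurable (A i), m.-negligible Z &
        forall x y : X, ~ Z x -> ~ Z y -> (forall i, A i x <-> A i y) -> x = y].

Definition aperiodic_system (R : realType) d (X : measurableType d)
    (m : probability X R) (T : X -> X) : Prop :=
  [/\ countably_separated m, measure_preserving m T & aperiodic m T].

Definition function_space (R : realType) : Type :=
  forall (d : measure_display) (X : measurableType d),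
    probability X R -> set (X -> R).

Definition L1_space (R : realType) : function_space R :=
  fun d X m => [set f : X -> R | m.-integrable setT (EFin \o f)].

Definition Lphi_space (R : realType) (phi : R -> R) : function_space R :=
  fun d X m => [set f : X -> R | measurable_fun setT f /\
    (\int[m]_x (`|f x| * phi `|f x|)%:E < +oo)%E].

Definition average (R : realType) (X : Type) (T : X -> X) (a : nat -> nat)
    (f : X -> R) (x : X) (N : nat) : R :=
  N%:R^-1 * \sum_(n < N) f (iter (a n) T x).

Definition universally_good (R : realType) (F : function_space R)
    (a : nat -> nat) : Prop :=
  forall (d : measure_display) (X : measurableType d) (m : probability X R)
         (T : X -> X),
    aperiodic_system m T ->
    forall f : X -> R, F d X m f ->
      {ae m, forall x, cvgn (average T a f x)}.

Definition universally_sweeping_out (R : realType) (F : function_space R)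
    (a : nat -> nat) : Prop :=
  forall (d : measure_display) (X : measurableType d) (m : probability X R)
         (T : X -> X),
    aperiodic_system m T ->
    exists2 f : X -> R, F d X m f &
      {ae m, forall x,
        ereal_sup [set (average T a f x N)%:E | N in [set N | (1 <= N)%N]]
        = +oo%E}.

(* Main.v *)
(** Add to [S] very sparse blocks [B_k], placed in [[N_k, 2 N_k)] with
    [|S(2 N_k)| <= 4 |S(N_k)|], where [B_k] is a progression of step [q_p]
    having about [|S(N_k)| / w_p] terms.  Zero density of [S] leaves room for
    such a progression.  The blocks come in groups: the [p]-th group has
    [q_p = 4^p w_p] blocks, one for each residue class mod [q_p], and [w_p]
    grows so fast that [phi (w_p / (p + 1)) >= (p + 1) 8^p].

    For [f] in [L phi(L)], only the part of [f] above [w_p / (p + 1)] matters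
    in the [p]-th group; its integral is [O(1 / phi (w_p / (p + 1)))], so
    Markov's inequality and Borel-Cantelli show that the contribution of the
    blocks to the averages tends to [0] almost everywhere.

    For the sweeping out in [L^1], a Rokhlin-type set [E_p] of measure at most
    [2 / q_p] contains, for most [x], all the [T^b x] with [b] in one residue
    class mod [q_p] and below a bound beyond the [p]-th group, hence along one
    whole block of the group.  The function [f = sum_p 2^p w_p 1_{E_p}] is
    integrable, and its average up to that block is at least [2^p / 12]. *)

Require Import Defs.
From HB Require Import structures.
From mathcomp Require Import all_boot all_order all_algebra.
From mathcomp Require Import finmap.
From mathcomp Require Import all_classical all_reals all_analysis.
From mathcomp Require Import measurable_realfun.
From mathcomp Require Import zify lra ring.

Set Implicit Arguments.
Unset Strict Implicit.

Import Order.TTheory GRing.Theory Num.Theory.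
Import numFieldNormedType.Exports.

Local Open Scope classical_set_scope.
Local Open Scope ring_scope.

(** * Increasing enumerations and counting functions *)

Lemma exists_increasing_enum (D : pred nat) :
  (forall n, exists2 m, (n <= m)%N & D m) ->
  exists2 a : nat -> nat, {homo a : m n / (m < n)%N} &
    forall b, D b <-> exists n, a n = b.
Proof.
move=> Dinf.
have Dex n : exists m, (n <= m)%N && D m by have [m nm Dm] := Dinf n; exists m; apply/andP.
pose nxt n := ex_minn (Dex n).
have nxtP n : [/\ (n <= nxt n)%N, D (nxt n) & forall m, (n <= m)%N -> D m -> (nxt n <= m)%N].
  rewrite /nxt; case: ex_minnP => m /andP[nm Dm] mmin; split => // k nk Dk.
  by apply: mmin; rewrite nk.
pose a := fix a n := if n is m.+1 then nxt (a m).+1 else nxt 0.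
have aS n : (a n < a n.+1)%N by have [] := nxtP (a n).+1.
have am : {homo a : m n / (m < n)%N} by apply: homo_ltn => // ? ? ?; exact: ltn_trans.
exists a => // b; split => [Db|[[|n] <-]]; last 2 first.
- by have [] := nxtP 0.
- by have [] := nxtP (a n).+1.
have age n : (n <= a n)%N by elim: n => // n IH; exact: leq_ltn_trans IH (aS n).
have : exists n, (b <= a n)%N by exists b.
move=> /ex_minnP[[|n] ban nmin].
  exists 0; apply/eqP; rewrite eqn_leq ban andbT.
  by have [_ _ ->] := nxtP 0.
exists n.+1; apply/eqP; rewrite eqn_leq ban andbT.
have [_ _ -> //] := nxtP (a n).+1.
by rewrite ltnNge; apply/negP => /nmin; rewrite ltnn.
Qed.

Lemma filter_enum (a : nat -> nat) (D : pred nat) M :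
  {homo a : m n / (m < n)%N} -> (forall b, D b <-> exists n, a n = b) ->
  seq.filter D (iota 0 M) = map a (iota 0 (count D (iota 0 M))).
Proof.
move=> am Da.
have aS n : (a n < a n.+1)%N by apply: am.
have age n : (n <= a n)%N by elim: n => // n IH; exact: leq_ltn_trans IH (aS n).
have : exists n, (M <= a n)%N by exists M.
move=> /ex_minnP[N MaN Nmin].
have lt_sorted k : sorted ltn (iota 0 k) by exact: iota_ltn_sorted.
suff E : seq.filter D (iota 0 M) = map a (iota 0 N).
  by rewrite -size_filter E size_map size_iota.
apply: (irr_sorted_eq ltn_trans ltnn).
- exact: sorted_filter ltn_trans _ _ (lt_sorted M).
- by rewrite (homo_sorted am).
move=> b; rewrite mem_filter mem_iota add0n leq0n /=.
apply/andP/mapP => [[/Da[n <-] naM]|[n]].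
  exists n => //; rewrite mem_iota /= add0n.
  by rewrite ltnNge; apply/negP => Nn;
    have := leq_trans MaN (ltnW_homo am Nn); rewrite leqNgt naM.
rewrite mem_iota add0n /= => nN ->; split; first by apply/Da; exists n.
by rewrite ltnNge; apply/negP => /Nmin; rewrite leqNgt nN.
Qed.

Lemma count_enum (a : nat -> nat) (D : pred nat) n :
  {homo a : m n / (m < n)%N} -> (forall b, D b <-> exists n, a n = b) ->
  count D (iota 0 (a n)) = n.
Proof.
move=> am Da.
have aN : seq.filter D (iota 0 (a n)) =i map a (iota 0 n).
  move=> b; rewrite mem_filter mem_iota add0n leq0n /=.
  apply/andP/mapP => [[/Da[m <-]]|[m]].
    by rewrite (leqW_mono (leq_mono am)) => mn; exists m; rewrite // mem_iota.
  rewrite mem_iota add0n /= => mn ->; split; last exact: am.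
  by apply/Da; exists m.
have ainj := incn_inj (leq_mono am).
rewrite -[RHS](size_iota 0) -[RHS](size_map a) -size_filter.
apply/eqP; rewrite -uniq_size_uniq ?filter_uniq ?iota_uniq //.
  by rewrite map_inj_uniq ?iota_uniq.
Qed.

Lemma leq_count_iota (D : pred nat) m n :
  (m <= n)%N -> (count D (iota 0 m) <= count D (iota 0 n))%N.
Proof. by move=> mn; rewrite -(subnKC mn) iotaD count_cat leq_addr. Qed.

Lemma count_iota_le (D : pred nat) n : (count D (iota 0 n) <= n)%N.
Proof. by rewrite -[leqRHS](size_iota 0) count_size. Qed.

Lemma count_unbounded (D : pred nat) B :
  (forall n, exists2 m, (n <= m)%N & D m) -> exists n, (B <= count D (iota 0 n))%N.
Proof.
move=> Dinf; elim: B => [|B [n Bn]]; first by exists 0.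
have [m nm Dm] := Dinf n; exists m.+1.
rewrite -[m.+1]addn1 iotaD count_cat /= add0n Dm addn0 addn1 ltnS.
by rewrite (leq_trans Bn) // leq_count_iota.
Qed.

(** * Choice of scales and construction of the blocks *)

(* [c (2 N)] cannot exceed [4 c N] for all large dyadic [N], since [c N <= N]. *)
Lemma doubling_scale (D : pred nat) (q B : nat) : (0 < q)%N ->
  (forall n, exists2 m, (n <= m)%N & D m) ->
  (exists N0, forall N, (N0 <= N)%N -> (q * count D (iota 0 N) <= N)%N) ->
  let c N := count D (iota 0 N) in
  exists u, [/\ (B <= c (q * u))%N, (c (q * u) <= u)%N
              & (c (2 * (q * u)) <= 4 * c (q * u))%N].
Proof.
move=> q0 Dinf [N0 cN0] c.
have [n1 Bn1] := count_unbounded B.+1 Dinf.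
pose J := maxn N0 n1.
have expJ j : (j <= q * 2 ^ j)%N.
  by rewrite (leq_trans (ltnW (ltn_expl j (ltnSn 1)))) // leq_pmull.
have big j : (J <= j)%N -> (B < c (q * 2 ^ j))%N && (c (q * 2 ^ j) <= 2 ^ j)%N.
  rewrite geq_max => /andP[Nj nj]; apply/andP; split.
    by apply: leq_trans Bn1 _; apply: leq_count_iota; apply: leq_trans nj (expJ j).
  by rewrite -(leq_pmul2l q0) cN0 // (leq_trans Nj).
(* If no dyadic scale from [J] on works, [c] more than quadruples at each doubling, against the
   bound [c N <= N]. *)
apply: contrapT => noU.
have grow j : (J <= j)%N -> (4 * c (q * 2 ^ j) < c (q * 2 ^ j.+1))%N.
  move=> /big /andP[Bc cj]; rewrite ltnNge; apply/negP => le4; apply: noU.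
  exists (2 ^ j)%N; split => //; first exact: ltnW.
  by rewrite mulnCA -expnS.
have pow i : (4 ^ i <= c (q * 2 ^ (J + i)))%N.
  elim: i => [|i IH].
    by rewrite addn0 expn0; have /andP[+ _] := big J (leqnn _); apply: leq_ltn_trans.
  rewrite addnS (leq_trans _ (ltnW (grow _ _))) ?leq_addr //.
  by rewrite expnS leq_mul2l IH orbT.
(* For this [i] the two bounds read [4 ^ i <= i * 2 ^ i], that is [2 ^ i <= i], which is absurd. *)
pose i := (q * 2 ^ J)%N.
have := leq_trans (pow i) (count_iota_le D _).
rewrite expnD mulnA -/i (_ : 4 = 2 * 2)%N // expnMn leq_pmul2r ?expn_gt0 //.
by rewrite leqNgt ltn_expl.
Qed.

Section BlockIndex.
Variable q : nat -> nat.
Hypothesis q_gt0 : forall p, (0 < q p)%N.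
Let Q p := (\sum_(i < p) q i)%N.

Lemma block_index k : exists pr : nat * nat, (pr.2 < q pr.1)%N /\ k = (Q pr.1 + pr.2)%N.
Proof.
elim: k => [|k [[p r] /= [rq ->]]].
  by exists (0, 0)%N; rewrite /Q big_ord0.
have [rq'|rq'] := ltnP r.+1 (q p); first by exists (p, r.+1); rewrite /= addnS.
exists (p.+1, 0)%N; split=> //=.
by rewrite /Q big_ord_recr /= addn0 -addnS; congr addn; apply/eqP; rewrite eqn_leq rq rq'.
Qed.

Lemma block_index_homo : {homo Q : m n / (m <= n)%N}.
Proof.
apply: homo_leq => [//|? ? ?|p]; first exact: leq_trans.
by rewrite /Q big_ord_recr leq_addr.
Qed.

Lemma block_index_inj p r p' r' : (r < q p)%N -> (r' < q p')%N ->
  (Q p + r = Q p' + r')%N -> p = p' /\ r = r'.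
Proof.
have QS i : Q i.+1 = (Q i + q i)%N by rewrite /Q big_ord_recr.
move=> rq rq' E; case: (ltngtP p p') => pp.
- have := block_index_homo pp; rewrite QS; lia.
- have := block_index_homo pp; rewrite QS; lia.
- by move: E; rewrite pp => /addnI ->.
Qed.

End BlockIndex.

(* The [p]-th group of blocks has indices [Q p + r] with [r < q p]; the block
   of index [Q p + r] consists of numbers congruent to [r] mod [q p]. *)
Lemma exists_blocks (D : pred nat) (q w : nat -> nat)
    (c := fun N => count D (iota 0 N)) (Q := fun p => (\sum_(i < p) q i)%N) :
  (forall p, (0 < q p)%N) -> (forall p, (0 < w p)%N) ->
  (forall n, exists2 m, (n <= m)%N & D m) ->
  (forall k, exists N0, forall N, (N0 <= N)%N -> (k * c N <= N)%N) ->
  exists (N : nat -> nat) (B : nat -> seq nat),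
  [/\ forall k, uniq (B k),
      forall k b, b \in B k -> (N k <= b < 2 * N k)%N,
      forall k, [/\ (0 < c (N k))%N, (2 * N k <= N k.+1)%N, (2 * N k <= c (N k.+1))%N
                  & (c (2 * N k) <= 4 * c (N k))%N] &
      forall p r, (r < q p)%N ->
        [/\ forall b, b \in B (Q p + r)%N -> b = r %[mod q p],
            (size (B (Q p + r)%N) * w p <= c (N (Q p + r)%N))%N &
            (c (N (Q p + r)%N) <= 2 * (w p * size (B (Q p + r)%N)))%N]].
Proof.
move=> q0 w0 Dinf Ddens.
have [pr prP] := choice (block_index q0).
pose qk k := q (pr k).1; pose wk k := w (pr k).1.
have exU k (B : nat) := doubling_scale B (q0 (pr k).1) Dinf (Ddens _).
have [U UP] := choice (fun kB : nat * nat => exU kB.1 kB.2).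
(* The lower bound passed to [U] has two aims: [wk k <= c (N k)] makes block [k] nonempty, and
   [2 * N k <= c (N k.+1)] makes the scales and the counts at least double at each step. *)
pose u := fix u k := if k is j.+1 then U (k, wk k + 2 * (qk j * u j))%N else U (0, wk 0)%N.
pose N k := (qk k * u k)%N; pose L k := (c (N k) %/ wk k)%N.
have wc k : (wk k <= c (N k))%N.
  case: k => [|k]; first by have [] := UP (0, wk 0)%N.
  have [+ _ _] := UP (k.+1, wk k.+1 + 2 * (qk k * u k))%N.
  by apply: leq_trans; rewrite leq_addr.
have Nc k : (2 * N k <= c (N k.+1))%N.
  have [+ _ _] := UP (k.+1, wk k.+1 + 2 * (qk k * u k))%N.
  by apply: leq_trans; rewrite leq_addl.
have cu k : (c (N k) <= u k)%N.
  case: k => [|k]; first by have [] := UP (0, wk 0)%N.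
  by have [] := UP (k.+1, wk k.+1 + 2 * (qk k * u k))%N.
have c2 k : (c (2 * N k) <= 4 * c (N k))%N.
  case: k => [|k]; first by have [] := UP (0, wk 0)%N.
  by have [] := UP (k.+1, wk k.+1 + 2 * (qk k * u k))%N.
have cle n : (c n <= n)%N by exact: count_iota_le.
have qk0 k : (0 < qk k)%N by exact: q0.
have wk0 k : (0 < wk k)%N by exact: w0.
have Lu k : (L k <= u k)%N by rewrite (leq_trans (leq_div _ _)).
(* Block [k] starts at [N k] plus the residue and has step [qk k]; [L k <= u k] keeps it below
   [2 * N k]. *)
exists N, (fun k => [seq qk k * (u k + i) + (pr k).2 | i <- iota 0 (L k)])%N.
split => [k|k b /mapP[i]|k|p r rq].
- rewrite map_inj_in_uniq ?iota_uniq // => i j _ _ /eqP.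
  by rewrite eqn_add2r eqn_pmul2l // eqn_add2l => /eqP.
- rewrite mem_iota add0n /= => iL ->; have [rq _] := prP k; rewrite -/(qk k) in rq.
  have := Lu k; rewrite /N; nia.
- split => //; first exact: leq_trans (wk0 k) (wc k).
  exact: leq_trans (Nc k) (cle _).
- set k := (Q p + r)%N.
  have [rq' E] := prP k.
  have [Ep Er] := block_index_inj rq rq' E.
  have Eq : qk k = q p by rewrite /qk Ep.
  have Ew : wk k = w p by rewrite /wk Ep.
  split => [b /mapP[i _ ->]||].
  + by rewrite Eq -Er mulnC modnMDl.
  + by rewrite size_map size_iota -Ew leq_divM.
  + rewrite size_map size_iota -Ew /L.
    (* The quotient is at least [1], so adding a remainder below [wk k] at most doubles
       [wk k * L k]. *)
    have := divn_eq (c (N k)) (wk k); have := ltn_pmod (c (N k)) (wk0 k).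
    have : (0 < c (N k) %/ wk k)%N by rewrite divn_gt0.
    nia.
Qed.

(** * Sums over the blocks *)

Lemma ler_sum_subset (R : numDomainType) (I : eqType) (s t : seq I) (g : I -> R) :
  (forall i, 0 <= g i) -> uniq t -> {subset t <= s} ->
  \sum_(i <- t) g i <= \sum_(i <- s) g i.
Proof.
move=> g0; elim: t s => [|x t IH] s /=; first by rewrite big_nil sumr_ge0.
move=> /andP[xt ut] ts.
have xs : x \in s by apply: ts; rewrite mem_head.
rewrite big_cons (perm_big _ (perm_to_rem xs)) big_cons lerD2l.
apply: IH => // y yt; have := ts y; rewrite inE yt orbT => /(_ isT).
rewrite (perm_mem (perm_to_rem xs)) inE => /orP[/eqP yx|//].
by rewrite -yx yt in xt.
Qed.

Section Blocks.
Variables (R : realType) (D P : pred nat) (N : nat -> nat) (B : nat -> seq nat).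
Let c M := count D (iota 0 M).
Hypothesis PB : forall b, P b -> exists k, b \in B k.
Hypothesis BN : forall k b, b \in B k -> (N k <= b)%N.
Hypothesis N2 : forall k, (0 < N k)%N /\ (2 * N k <= N k.+1)%N.
Hypothesis Nc : forall k, (2 * N k <= c (N k.+1))%N.

Lemma block_bounds_homo : {homo N : m n / (m < n)%N}.
Proof.
apply: homo_ltn => [? ? ?|k]; first exact: ltn_trans.
by have [] := N2 k; lia.
Qed.

(** An added term [b < M <= N k] lies in some [B j] with [N j <= b < N k], which forces [j < k]. *)
Lemma block_sum_le (g : nat -> R) k M : (forall b, 0 <= g b) -> (M <= N k)%N ->
  \sum_(b <- iota 0 M | P b) g b <= \sum_(j < k) \sum_(b <- B j) g b.
Proof.
move=> g0 MN; rewrite -big_filter.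
have -> : \sum_(j < k) \sum_(b <- B j) g b =
    \sum_(b <- flatten [seq B j | j <- iota 0 k]) g b.
  rewrite big_flatten big_map -(big_mkord predT (fun j => \sum_(b <- B j) g b)).
  by rewrite /index_iota subn0.
apply: ler_sum_subset => //; first by rewrite filter_uniq ?iota_uniq.
move=> b; rewrite mem_filter mem_iota /= add0n => /andP[/PB[j bj] bM].
apply/flattenP; exists (B j) => //; apply/mapP; exists j => //.
rewrite mem_iota /= add0n -(leqW_mono (leq_mono block_bounds_homo)).
exact: leq_ltn_trans (BN bj) (leq_trans bM MN).
Qed.

(* [c (N k)] at least doubles at each step, so the last block dominates. *)
Lemma block_sum_geom (g : nat -> R) (lam : R) K : 0 <= lam ->
  (forall k, (K <= k)%N -> \sum_(b <- B k) g b <= lam * (c (N k))%:R) ->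
  forall k, (K <= k)%N -> \sum_(j < k) \sum_(b <- B j) g b <=
     \sum_(j < K) \sum_(b <- B j) g b + lam * (c (N k))%:R.
Proof.
move=> lam0 small; elim=> [|k IH].
  by rewrite leqn0 => /eqP ->; rewrite big_ord0 add0r mulr_ge0.
rewrite leq_eqVlt => /orP[/eqP ->|]; first by rewrite lerDl mulr_ge0.
rewrite ltnS => Kk; rewrite big_ord_recr /=.
apply: le_trans (lerD (IH Kk) (small _ Kk)) _.
(* The two copies of [lam * c (N k)] are absorbed by [2 * c (N k) <= 2 * N k <= c (N k.+1)]. *)
rewrite -addrA lerD2l -mulrDr ler_wpM2l // -natrD ler_nat.
by have := Nc k; have := count_iota_le D (N k); rewrite -/(c _); lia.
Qed.

(** For [N k <= M < N k.+1], the added terms below [M] lie in the first [k.+1] blocks. The blocks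
    before [K] give a constant, negligible against [c M]; the later ones before [k], and block [k]
    itself, give at most [lam * c (N k) <= lam * c M] each time. *)
Lemma block_sum_negligible (g : nat -> R) : (forall b, 0 <= g b) ->
  (forall lam, 0 < lam -> exists K, forall k, (K <= k)%N ->
     \sum_(b <- B k) g b <= lam * (c (N k))%:R) ->
  (fun M => (\sum_(b <- iota 0 M | P b) g b) / (c M)%:R) @ \oo --> (0 : R).
Proof.
move=> g0 small; apply/cvgrPdist_le => e e0.
have e4 : 0 < e / 4 by rewrite divr_gt0.
have [K smallK] := small _ e4.
pose W := \sum_(j < K) \sum_(b <- B j) g b.
have W0 : 0 <= W by apply: sumr_ge0 => j _; exact: sumr_ge0.
have Nk k : (k <= N k)%N.
  elim: k => // k IH; exact: leq_ltn_trans IH (block_bounds_homo (ltnSn k)).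
(* Once [c M >= m.+1], the constant [W] is at most [e / 4 * c M]; the total is then at most three
   quarters of [e * c M]. *)
pose m := Num.truncn (W / (e / 4)).
exists (N (maxn K m.+1).+1) => // M /= NM.
have : exists k, (M < N k)%N by exists M.+1.
move=> /ex_minnP[k Mk kmin].
have maxk : ((maxn K m.+1).+1 < k)%N.
  by rewrite -(leqW_mono (leq_mono block_bounds_homo)) (leq_ltn_trans NM Mk).
case: k => // k in Mk kmin maxk *.
rewrite ltnS gtn_max in maxk; case/andP: maxk => Kk mk.
have NkM : (N k <= M)%N by rewrite leqNgt; apply/negP => /kmin; rewrite ltnn.
have cM : (c (N k) <= c M)%N by exact: leq_count_iota.
have ck : (m.+1 <= c (N k))%N.
  case: k mk {Kk kmin Mk} NkM cM => // k mk _ _.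
  by apply: leq_trans (Nc k); have := Nk k; lia.
have cM0 : (0 : R) < (c M)%:R by rewrite ltr0n (leq_trans _ cM) // (leq_trans _ ck).
rewrite sub0r normrN ger0_norm ?divr_ge0 ?sumr_ge0 //.
rewrite ler_pdivrMr //.
apply: le_trans (block_sum_le g0 (ltnW Mk)) _.
rewrite big_ord_recr /=.
apply: le_trans (lerD (block_sum_geom (ltW e4) smallK (ltnW Kk)) (smallK _ (ltnW Kk))) _.
rewrite -/W.
have WM : W <= e / 4 * (c M)%:R.
  rewrite -ler_pdivrMl // mulrC ltW // (lt_le_trans (truncnS_gt _)) // ler_nat.
  exact: leq_trans cM.
have : e / 4 * (c (N k))%:R <= e / 4 * (c M)%:R by rewrite ler_pM2l // ler_nat.
by move: WM; set a := _ * (c M)%:R; set b := _ * (c (N k))%:R; rewrite /a; nra.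
Qed.

End Blocks.

(** * Averages along a sequence and along its perturbation *)

Lemma sum_increasing_enum (R : realType) (a : nat -> nat) (D : pred nat) (g : nat -> R) M :
  {homo a : m n / (m < n)%N} -> (forall b, D b <-> exists n, a n = b) ->
  \sum_(b <- iota 0 M | D b) g b = \sum_(n < count D (iota 0 M)) g (a n).
Proof.
move=> am Da; rewrite -big_filter (filter_enum M am Da) big_map.
by rewrite -(big_mkord predT (fun n => g (a n))) /index_iota subn0.
Qed.

Lemma homo_ltn_cvgny (a : nat -> nat) :
  {homo a : m n / (m < n)%N} -> a @ \oo --> \oo.
Proof.
move=> am; apply/cvgnyPge => A; exists A => // n /= An; apply: leq_trans An _.
elim: n => // n IH; exact: leq_ltn_trans IH (am _ _ (ltnSn n)).
Qed.

Lemma increasing_enum_unbounded (a : nat -> nat) (D : pred nat) :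
  {homo a : m n / (m < n)%N} -> (forall b, D b <-> exists n, a n = b) ->
  forall n, exists2 m, (n <= m)%N & D m.
Proof.
move=> am Da n; exists (a n); last by apply/Da; exists n.
elim: n => // n IH; exact: leq_ltn_trans IH (am _ _ (ltnSn n)).
Qed.

Lemma count_cvgny (D : pred nat) : (forall n, exists2 m, (n <= m)%N & D m) ->
  (fun M => count D (iota 0 M)) @ \oo --> \oo.
Proof.
move=> Dinf; apply/cvgnyPge => A.
have [n An] := count_unbounded A Dinf.
by exists n => // m /= nm; apply: leq_trans An _; exact: leq_count_iota.
Qed.

(** The first [n] terms of [a] are [e n] terms of [S] and [d n] others, with sum [r n]. Dividing by
    [e n], the average along [a] is that along [S] plus [r n / e n], all multiplied by
    [(1 + d n / e n)^-1], and both ratios tend to [0]. *)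
Lemma average_perturbation_cvg (R : realType) (S a : nat -> nat)
    (E P D : pred nat) (g : nat -> R) (l : R)
    (c := fun M => count E (iota 0 M)) :
  {homo S : m n / (m < n)%N} -> (forall b, E b <-> exists n, S n = b) ->
  {homo a : m n / (m < n)%N} -> (forall b, D b <-> exists n, a n = b) ->
  (forall b, D b = E b || P b) ->
  (fun n => n%:R^-1 * \sum_(i < n) g (S i)) @ \oo --> l ->
  (fun M => (\sum_(b <- iota 0 M | P b) `|g b|) / (c M)%:R) @ \oo --> (0 : R) ->
  (fun M => (count P (iota 0 M))%:R / (c M)%:R) @ \oo --> (0 : R) ->
  (fun n => n%:R^-1 * \sum_(i < n) g (a i)) @ \oo --> l.
Proof.
move=> Sm SE am aD DE Sl gP cP.
have ainf := homo_ltn_cvgny am.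
have Einf := increasing_enum_unbounded Sm SE.
have cinf : (c \o a) @ \oo --> \oo by apply: cvg_comp (count_cvgny Einf).
pose e n := c (a n).
(* [P] may overlap [E]; only its part outside [E] is new. *)
pose r n := \sum_(b <- iota 0 (a n) | P b && ~~ E b) g b.
pose d n := count (fun b => P b && ~~ E b) (iota 0 (a n)).
have split_sum n : \sum_(i < n) g (a i) = \sum_(i < e n) g (S i) + r n.
  have := sum_increasing_enum g (a n) am aD; rewrite (count_enum n am aD) => <-.
  rewrite (bigID E) /=.
  rewrite /e /c -(sum_increasing_enum _ _ Sm SE); congr (_ + _); apply: eq_bigl => b.
    by rewrite DE; case: (E b); rewrite ?andbF.
  by rewrite DE; case: (E b); rewrite ?andbF ?andbT.
have split_count n : n = (e n + d n)%N.
  rewrite -{1}(count_enum n am aD) /e /c /d -count_predUI.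
  rewrite [X in (_ + X)%N](_ : _ = 0)%N ?addn0.
    by apply: eq_count => b /=; rewrite DE; case: (E b) => //=; rewrite andbT.
  by apply/eqP; rewrite eqn0Ngt -has_count; apply/hasPn => b _ /=; case: (E b); rewrite ?andbF.
have de0 : (fun n => (d n)%:R / (e n)%:R : R) @ \oo --> (0 : R).
  apply: (@squeeze_cvgr _ _ _ _ (cst 0) (fun n => (count P (iota 0 (a n)))%:R / (e n)%:R)).
  - apply: nearW => n; rewrite divr_ge0 //= ler_wpM2r ?invr_ge0 // ler_nat.
    by apply: sub_count => b /andP[].
  - exact: cvg_cst.
  - exact: (cvg_comp _ _ ainf cP).
have re0 : (fun n => r n / (e n)%:R : R) @ \oo --> (0 : R).
  apply: norm_cvg0.
  apply: (@squeeze_cvgr _ _ _ _ (cst 0)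
     (fun n => (\sum_(b <- iota 0 (a n) | P b) `|g b|) / (e n)%:R)).
  - apply: nearW => n; rewrite normr_ge0 /= normrM normfV (@ger0_norm _ (e n)%:R) //.
    rewrite ler_wpM2r ?invr_ge0 //; apply: le_trans (ler_norm_sum _ _ _) _.
    rewrite [leRHS](bigID E) /= lerDr; exact: sumr_ge0.
  - exact: cvg_cst.
  - exact: (cvg_comp _ _ ainf gP).
have en1 : (fun n => (1 + (d n)%:R / (e n)%:R : R)^-1) @ \oo --> (1 : R).
  rewrite -[X in _ --> X]invr1; apply: cvgV; first by rewrite oner_eq0.
  rewrite -[X in _ --> X]addr0; apply: cvgD => //; exact: cvg_cst.
have Se : (fun n => (e n)%:R^-1 * \sum_(i < e n) g (S i)) @ \oo --> l.
  exact: (cvg_comp _ _ cinf Sl).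
have : (fun n => (1 + (d n)%:R / (e n)%:R : R)^-1 *
    ((e n)%:R^-1 * (\sum_(i < e n) g (S i)) + r n / (e n)%:R)) @ \oo --> 1 * (l + 0).
  by apply: cvgM => //; apply: cvgD.
rewrite addr0 mul1r; apply: cvg_trans; apply: near_eq_cvg.
(* The factorization divides by [e n], so it is claimed only once [e n >= 1]. *)
have /cvgnyPge/(_ 1%N) := cinf; apply: filterS => n /= en0.
rewrite split_sum (_ : n%:R = (e n)%:R + (d n)%:R :> R); last by rewrite -natrD -split_count.
have e0 : (e n)%:R != 0 :> R by rewrite pnatr_eq0 -lt0n.
have ed0 : (e n)%:R + (d n)%:R != 0 :> R by rewrite -natrD pnatr_eq0 addn_eq0 negb_and -lt0n en0.
by field; rewrite ed0 e0.
Qed.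

(** * Translation of densities into list counts *)

(** [count_below] starts at [1] and [iota 0 N] at [0], hence the condition at [0]. *)
Lemma count_belowE (A : set nat) (D : pred nat) N :
  (forall b, A b <-> D b) -> ~~ D 0 -> count_below A N = count D (iota 0 N).
Proof.
move=> AD D0; rewrite /count_below.
rewrite (_ : A `&` _ = [set` [fset x | x in [seq b <- iota 0 N | D b]]%fset]).
  by rewrite set_fsetK card_fseq undup_id ?filter_uniq ?iota_uniq // size_filter.
apply/seteqP; split => b /=; rewrite !inE mem_filter mem_iota /= add0n.
  by move=> [/AD -> /andP[_ ->]].
move=> /andP[Db ->]; rewrite andbT; split; first exact/AD.
by case: b Db => // /(negP D0).
Qed.

Lemma zero_density_count (R : realType) (A : set nat) (D : pred nat) :
  (forall b, A b <-> D b) -> ~~ D 0 -> zero_density R A ->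
  forall k, exists N0, forall N, (N0 <= N)%N -> (k * count D (iota 0 N) <= N)%N.
Proof.
move=> AD D0 /cvgrPdist_le zA k.
have k0 : 0 < k.+1%:R^-1 :> R by rewrite invr_gt0.
have [N0 _ N0P] := zA _ k0; exists N0 => N /N0P /=.
rewrite sub0r normrN ger0_norm ?divr_ge0 // (count_belowE _ AD D0).
case: N => [|N]; first by rewrite muln0.
rewrite ler_pdivrMr // mulrC ler_pdivlMr // -natrM ler_nat mulnC.
by apply: leq_trans; rewrite leq_mul2r leqnSn orbT.
Qed.

(** * Iterates of a measure-preserving map, and Borel-Cantelli *)

Section MeasurePreserving.
Context (R : realType) d (X : measurableType d) (m : probability X R) (T : X -> X).
Hypothesis mpT : measure_preserving m T.

Lemma measurable_iter n : measurable_fun setT (iter n T).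
Proof.
by elim: n => [|n IH]; [exact: measurable_id|exact: measurableT_comp mpT.1 IH].
Qed.

Lemma measurable_preimage_iter n A : measurable A -> measurable (iter n T @^-1` A).
Proof. by move=> mA; rewrite -[X in measurable X]setTI; exact: measurable_iter. Qed.

Lemma measure_iter n A : measurable A -> m (iter n T @^-1` A) = m A.
Proof.
move=> mA; elim: n => [//|n IH]; rewrite -IH -[RHS]mpT.2; last exact: measurable_preimage_iter.
by congr (m _); apply/seteqP; split => x /=; rewrite -iterS iterSr.
Qed.

Lemma ae_iter (P : X -> Prop) :
  {ae m, forall x, P x} -> {ae m, forall x, forall n, P (iter n T x)}.
Proof.
move=> [A [mA A0 PA]]; apply: ae_foralln => n.
exists (iter n T @^-1` A); split; first exact: measurable_preimage_iter.
  exact: etrans (measure_iter n mA) A0.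
by move=> x /= nP; apply: PA.
Qed.

Lemma integral_iter n (f : X -> \bar R) : measurable_fun setT f ->
  (forall x, 0 <= f x)%E -> (\int[m]_x f (iter n T x) = \int[m]_x f x)%E.
Proof.
move=> mf f0.
have := ge0_integral_pushforward (measurable_iter n) m measurableT mf (fun y _ => f0 y).
rewrite preimage_setT => <-; apply: eq_measure_integral; first exact: measurable_iter.
by move=> mT A mA _; exact: measure_iter.
Qed.

End MeasurePreserving.

Lemma nneseries_geometric_lty (R : realType) (u : nat -> \bar R) (C : R) :
  (forall p, 0 <= u p)%E -> (forall p, u p <= (C * 2^-1 ^+ p)%:E)%E ->
  (\sum_(p <oo) u p < +oo)%E.
Proof.
move=> u0 uC.
have h0 : 0 <= C by have := le_trans (u0 _) (uC 0%N); rewrite expr0 mulr1 lee_fin.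
apply: (@le_lt_trans _ _ (\sum_(p <oo) (geometric C 2^-1 p)%:E)%E).
  by apply: lee_nneseries => // p *; exact: uC.
apply: (@le_lt_trans _ _ (C * 2)%:E); last exact: ltry.
apply: lime_le.
  by apply: is_cvg_nneseries => p _ _; rewrite lee_fin mulr_ge0 // exprn_ge0.
apply: nearW => k; rewrite sumEFin lee_fin.
rewrite -mulr_sumr ler_wpM2l //.
have := subrX1 (2^-1 : R) k; rewrite big_mkord.
have : 0 <= 2^-1 ^+ k :> R by rewrite exprn_ge0.
set s := \sum_(i < k) _; set t := _ ^+ k; nra.
Qed.

Lemma borel_cantelli_geometric (R : realType) d (X : measurableType d)
    (m : probability X R) (G : nat -> set X) (C : R) :
  (forall p, measurable (G p)) -> (forall p, m (G p) <= (C * 2^-1 ^+ p)%:E)%E ->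
  {ae m, forall x, exists p0, forall p, (p0 <= p)%N -> ~ G p x}.
Proof.
move=> mG mGC.
have mlim : measurable (lim_sup_set G).
  by apply: bigcap_measurable => // k _; apply: bigcup_measurable => j _.
exists (lim_sup_set G); split => //.
  apply: lim_sup_set_cvg0 => //.
  by apply: nneseries_geometric_lty mGC => p; exact: measure_ge0.
move=> x /= Hx n _; apply: contrapT => Gx; apply: Hx; exists n => p np Gp.
by apply: Gx; exists p.
Qed.

(** * Small sections of aperiodic systems *)

Section MeasurePreserving.
Context (R : realType) d (X : measurableType d) (m : probability X R) (T : X -> X).
Hypothesis mpT : measure_preserving m T.

(** Removing the null set of returning points leaves [A1], whose preimages under the iterates [0] to
    [n] are disjoint and have the measure of [A]; together these [n.+1] sets have measure at most
    [1]. *)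
Lemma measure_ae_disjoint_iter (A : set X) n : measurable A ->
  (forall k, (1 <= k <= n)%N -> m.-negligible (A `&` iter k T @^-1` A)) ->
  (m A <= (n.+1%:R^-1)%:E)%E.
Proof.
move=> mA Anull.
have mBk k : measurable (A `&` iter k T @^-1` A).
  by apply: measurableI => //; exact: (measurable_preimage_iter mpT).
pose B := \bigcup_(k in [set k | (1 <= k <= n)%N]) (A `&` iter k T @^-1` A).
have mB : measurable B by apply: bigcup_measurable.
have B0 : m B = 0%E.
  apply/negligibleP => //; rewrite /B bigcup_mkcond; apply: negligible_bigcup => k.
  by case: ifPn => [/set_mem/Anull //|_]; exact: negligible_set0.
pose A1 := A `\` B.
have mA1 : measurable A1 by exact: measurableD.
have -> : m A = m A1.
  apply/eqP; rewrite eq_le; apply/andP; split; last first.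
    by apply: le_measure; rewrite ?inE //; exact: subDsetl.
  rewrite -[leRHS]adde0 -B0; apply: le_trans (measureU2 _ mA1 mB).
  apply: le_measure; rewrite ?inE //; first exact: measurableU.
  by move=> x Ax; rewrite /A1; have [Bx|nBx] := pselect (B x); [right|left].
have tF : trivIset setT (fun k : 'I_n.+1 => iter k T @^-1` A1).
  suff lt_disj i j x : (i < j < n.+1)%N -> A1 (iter i T x) -> ~ A1 (iter j T x).
    move=> i j _ _ [x [/= Ai Aj]]; apply/val_inj; case: (ltngtP i j) => //= ij.
      by case: (lt_disj i j x) => //; rewrite ij ltn_ord.
    by case: (lt_disj j i x) => //; rewrite ij ltn_ord.
  move=> /andP[ij jn] [Ai nBi] [Aj _]; apply: nBi; exists (j - i)%N => /=.
    by rewrite subn_gt0 ij /=; lia.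
  by split => //=; rewrite -iterD subnK // ltnW.
have mF (k : 'I_n.+1) : measurable (iter k T @^-1` A1) by exact: (measurable_preimage_iter mpT).
have E : m (\big[setU/set0]_(i < n.+1) (iter i T @^-1` A1)) = (\sum_(i < n.+1) m A1)%E.
  rewrite (measure_bigsetU_ord m xpredT mF tF); apply: eq_bigr => i _.
  exact: (measure_iter mpT).
have : (m (\big[setU/set0]_(i < n.+1) (iter i T @^-1` A1)) <= 1)%E.
  by apply: probability_le1; exact: bigsetU_measurable.
rewrite E -[m A1]fineK ?fin_num_measure // sumEFin !lee_fin sumr_const card_ord.
by rewrite -[_^-1]mul1r ler_pdivlMr // mulr_natr.
Qed.
End MeasurePreserving.

Section SmallSections.
Context (R : realType) d (X : measurableType d) (m : probability X R) (T : X -> X).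

(* The [C j] are the cells of the finite partitions generated by the separating
   sets, minus the points that return to their cell within [n] steps; a point
   and its first [n] iterates are distinct, so they are told apart by some
   partition. *)
Lemma separated_cover (n : nat) : aperiodic_system m T ->
  exists C : nat -> set X, [/\ forall j, measurable (C j),
    forall j k, (1 <= k <= n)%N -> C j `&` iter k T @^-1` C j = set0 &
    {ae m, forall x, exists j, C j x}].
Proof.
move=> [[A [Z [mA Z0 sepA]]] mpT apT].
pose cell (s : seq bool) := [set z | forall i, (i < size s)%N -> (A i z <-> nth false s i)].
have mcell s : measurable (cell s).
  rewrite (_ : cell s = \bigcap_(i in [set i | (i < size s)%N])
      (if nth false s i then A i else ~` A i)).
    by apply: bigcap_measurableType => i _; case: ifP => _ //; exact: measurableC.
  apply/seteqP; split => x /= H i /= /H; case: (nth _ _ _) => //=.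
  - by move=> ->.
  - by case=> nA _ /nA.
pose Cs s := cell s `\` \bigcup_(k in [set k | (1 <= k <= n)%N]) (iter k T @^-1` cell s).
have mCs s : measurable (Cs s).
  apply: measurableD => //; apply: bigcup_measurable => k _.
  exact: (measurable_preimage_iter mpT).
exists (fun j => if choice.unpickle j is Some s then Cs s else set0); split.
- by move=> j; case: choice.unpickle.
- move=> j k kn; case: choice.unpickle => [s|]; last by rewrite set0I.
  apply/seteqP; split => x //= [[_ nx] [kx _]]; apply: nx; by exists k.
have aeZ : {ae m, forall x, ~ Z x}.
  by apply: negligibleS Z0 => x /= /contrapT.
have aeZ' := ae_iter mpT aeZ.
have aeP : {ae m, forall x, forall k, (1 <= k)%N -> iter k T x <> x}.
  apply: ae_foralln => k; have [k0|k0] := leqP 1 k; last by apply: aeW.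
  by apply: negligibleS (apT k k0) => x /= nx; apply: contrapT => xk; apply: nx.
move: aeZ' aeP; apply: filterS2 => x xZ xP.
have sepx k : exists i, (1 <= k)%N -> ~ (A i x <-> A i (iter k T x)).
  have [k0|k0] := leqP 1 k; last by exists 0%N.
  apply: contrapT => nsep; apply: (xP k k0); apply/esym/sepA; [exact: (xZ 0%N)|exact: xZ|].
  by move=> i; apply: contrapT => nA; apply: nsep; exists i.
have [idx idxP] := choice sepx.
(* [M] exceeds each [idx k] with [k <= n], so the cell given by the first [M] bits of [x] contains
   no [iter k T x] with [1 <= k <= n]. *)
pose M := (\max_(k < n.+1) (idx k).+1)%N.
pose s := mkseq (fun i => `[< A i x >]) M.
have sE i : (i < M)%N -> nth false s i = `[< A i x >] by move=> iM; rewrite nth_mkseq.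
exists (choice.pickle s); rewrite choice.pickleK; split.
  by move=> i; rewrite size_mkseq => iM; rewrite sE //; split => [/asboolP|/asboolP].
move=> [k /= /andP[k0 kn]] /(_ (idx k)).
have iM : (idx k < M)%N.
  by rewrite /M; apply: (leq_bigmax_cond (Ordinal (kn : k < n.+1)%N)).
rewrite size_mkseq sE // => /(_ iM) H; apply: (idxP k k0).
by rewrite H; split => [/asboolP|/asboolP].
Qed.

(* With [D j] the set of points whose orbit meets [C j], take the union of the
   [C j] minus the earlier [D i]: since [D j] is invariant up to a null set, no
   point of the union returns to it within [n] steps, outside a null set. *)
Lemma small_section (n : nat) : aperiodic_system m T ->
  exists A : set X, [/\ measurable A, (m A <= (n.+1%:R^-1)%:E)%E &
    {ae m, forall x, exists k, A (iter k T x)}].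
Proof.
move=> apT; have [_ mpT _] := apT.
have [C [mC dC aeC]] := separated_cover n apT.
pose D j := \bigcup_k (iter k T @^-1` C j).
have mD j : measurable (D j).
  by apply: bigcup_measurable => k _; exact: (measurable_preimage_iter mpT).
pose C' j := C j `\` \bigcup_(i in [set i | (i < j)%N]) D i.
pose A := \bigcup_j C' j.
have mA : measurable A.
  by apply: bigcup_measurable => j _; apply: measurableD => //; apply: bigcup_measurable.
have DT j k : iter k T @^-1` D j `<=` D j.
  by move=> x [i _ /=]; rewrite -iterD => Cx; exists (i + k)%N.
exists A; split => //; last first.
  apply: filterS aeC => x [j Cjx].
  have : exists j, `[< D j x >] by exists j; apply/asboolP; exists 0%N.
  move=> /ex_minnP[i /asboolP[k _ Ck] imin].
  exists k; exists i => //; split => // -[l /= li Dl].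
  have : `[< D l x >] by apply/asboolP; exact: (DT l k).
  by move=> /imin; rewrite leqNgt li.
apply: (measure_ae_disjoint_iter mpT) => // k kn.
have : m.-negligible (\bigcup_j (D j `\` iter k T @^-1` D j)).
  apply: negligible_bigcup => j.
  have mkD := measurable_preimage_iter mpT k (mD j).
  apply/negligibleP; first exact: measurableD.
  (* The preimage of [D j] lies inside [D j] and has the same finite measure. *)
  rewrite measureD ?ltey_eq ?fin_num_measure // setIidr; last exact: DT.
  rewrite [X in (_ - X)%E](_ : _ = m (D j)); last exact: (measure_iter mpT).
  by rewrite subee // fin_num_measure.
apply: negligibleS => x [[j _ [Cx nDx]] [l _ [Cl nDl]]].
(* Here [x] is in [C' j] and [iter k T x] in [C' l]. If [j < l], the orbit of [x] has left [D j], a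
   null event; if [l < j], then [x] is in [D l], which [C' j] excludes; if [j = l], the cell would
   return to itself. *)
case: (ltngtP j l) => jl.
- exists j => //; split; first by exists 0%N.
  by move=> Djk; apply: nDl; exists j.
- exfalso; apply: nDx; exists l => //; exists k => //.
- by have := dC j k kn; rewrite -subset0 => /(_ x); case; split => //; rewrite jl.
Qed.

End SmallSections.

(** * Rokhlin-type sets for residue classes *)

(** Each sampled value is at most each of the [q] values of [h] on the window ending at it, and
    these windows tile the range. *)
Lemma sum_decreasing_multiples (R : realDomainType) (h : nat -> R) (q I : nat) :
  (forall n, h n.+1 <= h n) ->
  q%:R * \sum_(i < I) h (i.+1 * q)%N <= \sum_(n < I * q) h n.+1.
Proof.
move=> hS.
have hD n k : h (n + k)%N <= h n by elim: k => [|k IH]; rewrite ?addn0 // addnS (le_trans (hS _)).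
elim: I => [|I IH]; first by rewrite mul0n !big_ord0 mulr0.
rewrite big_ord_recr /= mulrDr mulSn [(q + _)%N]addnC big_split_ord /=.
apply: lerD IH _; rewrite mulr_natl -[X in _ *+ X]card_ord -sumr_const.
apply: ler_sum => j _.
have -> : (I * q + q = (I * q + j).+1 + (q - j.+1))%N by have := ltn_ord j; lia.
exact: hD.
Qed.

Section Tower.
Context (R : realType) d (X : measurableType d) (m : probability X R) (T : X -> X).

(* [E] is the set of points whose first hitting time of a small section is a
   multiple of [q]: the hitting time decreases by one along the orbit, and its
   law is nonincreasing, so that [m E] is about [1 / q]. *)
Lemma residue_tower (q M : nat) (eps : R) : (0 < q)%N -> 0 < eps ->
  aperiodic_system m T ->
  exists E G : set X, [/\ measurable E, measurable G, (m E <= (2 / q%:R)%:E)%E,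
    (m G <= eps%:E)%E &
    forall x, ~ G x -> exists2 r, (r < q)%N &
      forall b, (b <= M)%N -> b = r %[mod q] -> E (iter b T x)].
Proof.
move=> q0 eps0 apT; have [_ mpT _] := apT.
(* The bound [n0 >= q] gives [m A <= 1 / q]; the other one makes [M * m A <= eps], which controls
   the points that hit [A] before time [M]. *)
pose n0 := maxn q (Num.truncn (M%:R / eps)).
have [A [mA Asmall aeA]] := small_section n0 apT.
pose hit k := iter k T @^-1` A.
have mhit k : measurable (hit k) by exact: (measurable_preimage_iter mpT).
pose H n := hit n `\` \bigcup_(i in [set i | (i < n)%N]) hit i.
have mH n : measurable (H n) by apply: measurableD => //; exact: bigcup_measurable.
pose never := \bigcap_i ~` hit i.
have mnever : measurable never by apply: bigcapT_measurable => i; exact: measurableC.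
have never0 : m never = 0%E.
  by apply/negligibleP => //; apply: negligibleS aeA => x nx [k Ak]; exact: (nx k).
pose early := \big[setU/set0]_(i < M) hit i.
have mearly : measurable early by exact: bigsetU_measurable.
pose h n := fine (m (H n)).
have hE n : m (H n) = (h n)%:E by rewrite fineK ?fin_num_measure.
have h0 n : 0 <= h n by rewrite fine_ge0.
(* A point with first hitting time [n.+1] moves to one with first hitting time [n], so [H n.+1] lies
   in the preimage of [H n]. *)
have hS n : h n.+1 <= h n.
  rewrite -lee_fin -!hE -[leRHS]mpT.2 //.
  apply: le_measure; rewrite ?inE //; first exact: (measurable_preimage_iter mpT 1 (mH n)).
  move=> x [Ax nAx]; split => /=; first by rewrite /hit /= -iterSr.
  move=> [i /= iltn Ai]; apply: nAx; exists i.+1 => //.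
  by rewrite /hit /= -iterS iterSr.
have hsum K : \sum_(n < K) h n <= 1.
  rewrite -lee_fin.
  have tH : trivIset setT (fun n : 'I_K => H n).
    suff lt_disj i j x : (i < j)%N -> H i x -> ~ H j x.
      move=> i j _ _ [x [/= Hi Hj]]; apply/val_inj; case: (ltngtP i j) => //= ij.
        by case: (lt_disj i j x).
      by case: (lt_disj j i x).
    by move=> ij [Ai _] [_ nA]; apply: nA; exists i.
  have <- : m (\big[setU/set0]_(n < K) H n) = (\sum_(n < K) h n)%:E.
    rewrite (measure_bigsetU_ord m xpredT (fun n : 'I_K => mH n) tH) -sumEFin.
    by apply: eq_bigr => n _; exact: hE.
  by apply: probability_le1; exact: bigsetU_measurable.
have qR0 : 0 < q%:R :> R by rewrite ltr0n.
have n0R : n0.+1%:R^-1 <= q%:R^-1 :> R.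
  by rewrite lef_pV2 ?posrE // ler_nat leqW // leq_maxl.
exists (\bigcup_i H (i * q)%N), (early `|` never); split.
- by apply: bigcup_measurable.
- exact: measurableU.
- apply: le_trans (measure_sigma_subadditive m (fun i => mH (i * q)%N) _ (@subset_refl _ _)) _.
    exact: bigcup_measurable.
  apply: lime_le; first by apply: is_cvg_nneseries => n _ _; exact: measure_ge0.
  apply: nearW => I; rewrite big_mkord.
  rewrite (eq_bigr (fun i : 'I_I => (h (i * q)%N)%:E)); last by move=> i _; exact: hE.
  rewrite sumEFin lee_fin.
  apply: (@le_trans _ _ (\sum_(i < I.+1) h (i * q)%N)).
    by rewrite big_ord_recr /= lerDl.
  (* Half of [2 / q] pays for hitting time [0], through [m A <= 1 / q]; the other half pays for the
     positive multiples of [q], by monotonicity of [h]. *)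
  rewrite big_ord_recl /= mul0n mulr2n mulrDl mul1r; apply: lerD.
    apply: le_trans n0R; rewrite -lee_fin -hE; apply: le_trans Asmall.
    by apply: le_measure; rewrite ?inE //; exact: subDsetl.
  rewrite -[q%:R^-1]mul1r ler_pdivlMr // mulrC.
  apply: le_trans (sum_decreasing_multiples q I hS) _.
  apply: le_trans (hsum (I * q).+1); rewrite [leRHS]big_ord_recl lerDr; exact: h0.
- apply: le_trans (measureU2 m mearly mnever) _.
  rewrite -[leRHS]adde0; apply: leeD; last by rewrite -never0.
  apply: le_trans (@content_subadditive _ _ _ m early hit M
    (fun i _ => mhit i) mearly (@subset_refl _ _)) _.
  rewrite (eq_bigr (fun _ => (fine (m A))%:E)); last first.
    by move=> i _; rewrite fineK ?fin_num_measure //; exact: (measure_iter mpT).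
  rewrite sumEFin sumr_const card_ord lee_fin -mulr_natl.
  apply: (@le_trans _ _ (M%:R * n0.+1%:R^-1)).
    rewrite ler_wpM2l // -lee_fin fineK ?fin_num_measure //.
  rewrite ler_pdivrMr // mulrC -ler_pdivrMr //.
  apply: le_trans (ltW (truncnS_gt _)) _; by rewrite ler_nat ltnS leq_maxr.
move=> x nG.
have : exists k, `[< hit k x >].
  apply: contrapT => nk; apply: nG; right => k _ hk; apply: nk; exists k; exact/asboolP.
move=> /ex_minnP[k /asboolP hk kmin].
have Mk : (M <= k)%N.
  rewrite leqNgt; apply/negP => kM; apply: nG; left.
  by rewrite /early -bigcup_mkord; exists k.
(* With [k >= M] the hitting time of [x], the point [iter b T x] has hitting time [k - b], a
   multiple of [q] exactly when [b] is congruent to [k]. *)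
exists (k %% q)%N; first by rewrite ltn_mod.
move=> b bM; rewrite modn_mod => /eqP bk.
have bk' := leq_trans bM Mk.
exists ((k - b) %/ q)%N => //.
rewrite divnK; last by rewrite -eqn_mod_dvd // eq_sym.
split; first by rewrite /hit /= -iterD subnK.
move=> [i /= ik]; rewrite /hit /= -iterD => Ai.
have : (k <= i + b)%N by apply: kmin; exact/asboolP.
lia.
Qed.
End Tower.

(** * The integrable function used for sweeping out *)

Section Sweeping.
Context (R : realType) d (X : measurableType d) (m : probability X R) (T : X -> X).

Lemma sweeping_function (q M : nat -> nat) (h : nat -> R) (C : R) :
  aperiodic_system m T -> (forall p, (0 < q p)%N) -> (forall p, 0 <= h p) ->
  (forall p, h p * (2 / (q p)%:R) <= C * 2^-1 ^+ p) ->
  exists f : X -> R, [/\ forall x, 0 <= f x, L1_space m f &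
    {ae m, forall x, exists p0, forall p, (p0 <= p)%N ->
      exists2 r, (r < q p)%N & forall b, (b <= M p)%N -> b = r %[mod q p] ->
        h p <= f (iter b T x)}].
Proof.
move=> apT q0 h0 hC; have [_ mpT _] := apT.
have e0 p : 0 < 2^-1 ^+ p :> R by rewrite exprn_gt0.
have ex p := residue_tower (M p) (q0 p) (e0 p) apT.
have [E exE] := choice ex.
have [G EG] := choice exE.
have mE p : measurable (E p) by have [] := EG p.
pose u p (x : X) := ((h p)%:E * (\1_(E p) x)%:E)%E.
have u0 p x : (0 <= u p x)%E by rewrite mule_ge0 // lee_fin.
have mu p : measurable_fun setT (u p).
  by apply: emeasurable_funM; [exact: measurable_cst|apply/measurable_EFinP].
pose F x := (\sum_(p <oo) u p x)%E.
have F0 x : (0 <= F x)%E by apply: nneseries_ge0 => p _ _; exact: u0.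
have mF : measurable_fun setT F by apply: ge0_emeasurable_sum => // k x _ _; exact: u0.
have iF : m.-integrable setT F.
  apply/integrableP; split => //.
  under eq_integral do rewrite gee0_abs //.
  rewrite integral_nneseries //.
  apply: (@nneseries_geometric_lty _ _ C) => p; first exact: integral_ge0.
  rewrite ge0_integralZl ?lee_fin //; last exact/measurable_EFinP.
  rewrite integral_indic // setIT.
  apply: (@le_trans _ _ ((h p)%:E * (2 / (q p)%:R)%:E)%E); last by rewrite lee_fin.
  by apply: lee_wpmul2l; [rewrite lee_fin|have [] := EG p].
pose f x := fine (F x).
exists f; split.
- by move=> x; exact: fine_ge0.
- apply: (le_integrable measurableT _ _ iF).
    apply/measurable_EFinP; apply: measurableT_comp => //.
  move=> x _ /=; rewrite /f; case: (F x) (F0 x) => [r| |] //=.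
  by rewrite normr0 leey.
(* [fine] sends an infinite value to [0], so the lower bound on [f] needs [F] finite along the whole
   orbit; [ae_iter] provides this. *)
have fin : {ae m, forall x, F x \is a fin_num}.
  by apply: filterS (integrable_ae measurableT iF) => x; exact.
have bc : {ae m, forall x, exists p0, forall p, (p0 <= p)%N -> ~ G p x}.
  by apply: (@borel_cantelli_geometric _ _ _ _ _ 1) => p; [|rewrite mul1r]; have [] := EG p.
move: (ae_iter mpT fin) bc; apply: filterS2 => x Fx [p0 nG].
exists p0 => p pp; have [_ _ _ _ /(_ _ (nG _ pp))[r rq Eb]] := EG p.
exists r => // b bM br; rewrite -lee_fin /f fineK //.
apply: le_trans (nneseries_lim_ge p.+1 _); last by move=> n _ _; exact: u0.
rewrite big_nat_recr //= /u indicE mem_set ?mule1; last exact: Eb.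
by apply: leeDr; apply: sume_ge0 => n _; exact: u0.
Qed.
End Sweeping.

(** * Block sums of functions in [Lphi_space] *)

Section BlockSums.
Context (R : realType) d (X : measurableType d) (m : probability X R) (T : X -> X).
Hypothesis mpT : measure_preserving m T.

(** By invariance of [m], the orbit sum has integral [size s] times that of [psi]; Markov's
    inequality does the rest. *)
Lemma markov_orbit_sum (psi : X -> R) (s : seq nat) (a K : R) :
  measurable_fun setT psi -> (forall x, 0 <= psi x) ->
  (\int[m]_x (psi x)%:E <= K%:E)%E -> 0 < a ->
  let A := [set x | a <= \sum_(b <- s) psi (iter b T x)] in
  measurable A /\ (m A <= ((size s)%:R * K / a)%:E)%E.
Proof.
move=> mpsi psi0 intK a0 A.
pose H x := (\sum_(b <- s) (psi (iter b T x))%:E)%E.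
have mb b : measurable_fun setT (fun x => (psi (iter b T x))%:E).
  by apply/measurable_EFinP; apply: measurableT_comp mpsi (measurable_iter mpT b).
have mH : measurable_fun setT H by apply: emeasurable_sum.
have H0 x : (0 <= H x)%E by apply: sume_ge0 => b _; rewrite lee_fin.
have AE : A = setT `&` [set x | (a%:E <= `|H x|)%E].
  rewrite setTI; apply/seteqP; split => x /=; by rewrite /A /= gee0_abs // /H sumEFin lee_fin.
have mA : measurable A.
  rewrite AE; apply: emeasurable_fun_c_infty => //; exact: measurableT_comp.
split => //.
have := @le_integral_comp_abse _ _ _ m setT measurableT H a id (@measurable_id _ _ _)
  (fun _ => id) (fun _ _ _ _ => id) mH a0.
rewrite -AE.
under [X in (_ <= X)%E -> _]eq_integral do rewrite gee0_abs //.
rewrite ge0_integral_sum //; last by move=> b x _; rewrite lee_fin.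
move=> AH.
have : (a%:E * m A <= ((size s)%:R * K)%:E)%E.
  apply: le_trans AH _.
  rewrite (eq_bigr (fun=> (\int[m]_x (psi x)%:E)%E)); last first.
    move=> b _; apply: (integral_iter mpT b (f := EFin \o psi)); first exact/measurable_EFinP.
    by move=> x; rewrite lee_fin.
  apply: (@le_trans _ _ (\sum_(b <- s) K%:E)%E); first exact: lee_sum.
  by rewrite sumEFin lee_fin big_const_seq count_predT iter_addr_0 mulr_natl.
rewrite -[m A]fineK ?fin_num_measure // -EFinM !lee_fin => ?.
by rewrite ler_pdivlMr // mulrC.
Qed.

(** The function [|f|] is cut at the level [v p]. By the size of the blocks, values below it
    contribute at most [c / (p + 1)]. Those above are at most [psi / phi (v p)], and Markov's
    inequality on all [q p] blocks makes their contribution as small outside a set of measure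
    [O(2 ^ -p)]. *)
Lemma Lphi_block_sums (phi : R -> R) (f : X -> R) (q v : nat -> nat)
    (B : nat -> seq nat) (c : nat -> nat)
    (Q := fun p => (\sum_(i < p) q i)%N) :
  (forall x y, x <= y -> phi x <= phi y) -> (forall x, 0 < phi x) ->
  Lphi_space phi m f ->
  (forall p, q p = (4 ^ p * (p.+1 * v p))%N) -> (forall p, (0 < v p)%N) ->
  (forall p, p.+1%:R * 8 ^+ p <= phi (v p)%:R) ->
  (forall k, (0 < c k)%N) ->
  (forall p r, (r < q p)%N -> (size (B (Q p + r)) * (p.+1 * v p) <= c (Q p + r))%N) ->
  {ae m, forall x, exists p0, forall p r, (p0 <= p)%N -> (r < q p)%N ->
    \sum_(b <- B (Q p + r)%N) `|f (iter b T x)| <= 2 / p.+1%:R * (c (Q p + r)%N)%:R}.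
Proof.
move=> phi_nd phi0 [mf intf] qE v0 phiv c0 Bc.
pose psi x := `|f x| * phi `|f x|.
have mpsi : measurable_fun setT psi.
  apply: measurable_funM; first exact: measurableT_comp.
  apply: (measurableT_comp (f := phi)); last exact: measurableT_comp.
  exact: nondecreasing_measurable.
have psi0 x : 0 <= psi x by rewrite mulr_ge0 // ltW.
have I0 : (0 <= \int[m]_x (psi x)%:E)%E by apply: integral_ge0 => x _; rewrite lee_fin.
pose K := fine (\int[m]_x (psi x)%:E)%E.
have intK : (\int[m]_x (psi x)%:E <= K%:E)%E by rewrite /K fineK // ge0_fin_numE.
have K0 : 0 <= K by exact: fine_ge0.
(* Off [A p r], dividing by [phi (v p)] bounds the contribution of the large values by
   [c / (p + 1)]. *)
pose a p r := phi (v p)%:R * ((c (Q p + r)%N)%:R / p.+1%:R) : R.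
have a0 p r : 0 < a p r by rewrite mulr_gt0 // divr_gt0 // ltr0n.
pose A p r := [set x | a p r <= \sum_(b <- B (Q p + r)%N) psi (iter b T x)].
pose G p := \big[setU/set0]_(r < q p) A p r.
have mA p r : measurable (A p r).
  by have [] := markov_orbit_sum (B (Q p + r)%N) mpsi psi0 intK (a0 p r).
have mG p : measurable (G p) by exact: bigsetU_measurable.
have GK p : (m (G p) <= (K * 2^-1 ^+ p)%:E)%E.
  apply: le_trans (@content_subadditive _ _ _ m (G p) (A p) (q p)
    (fun i _ => mA p i) (mG p) (@subset_refl _ _)) _.
  have Apr (r : 'I_(q p)) : (m (A p r) <= (K / ((v p)%:R * phi (v p)%:R))%:E)%E.
    have [_ /le_trans] := markov_orbit_sum (B (Q p + r)%N) mpsi psi0 intK (a0 p r).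
    apply; rewrite lee_fin /a.
    have := Bc p r (ltn_ord r); rewrite -(ler_nat R) !natrM => Bcr.
    have ck : 0 < (c (Q p + r)%N)%:R :> R by rewrite ltr0n.
    have vk : 0 < (v p)%:R :> R by rewrite ltr0n.
    have phk := phi0 (v p)%:R.
    have pk : 0 < p.+1%:R :> R by [].
    rewrite ler_pdivrMr; last by rewrite mulr_gt0 // divr_gt0.
    rewrite [leRHS](_ : _ = K * ((c (Q p + r)%N)%:R / (p.+1%:R * (v p)%:R))); last first.
      by field; rewrite !gt_eqF //.
    by rewrite mulrC ler_wpM2l // ler_pdivlMr // mulr_gt0.
  apply: (@le_trans _ _ (\sum_(r < q p) (K / ((v p)%:R * phi (v p)%:R))%:E)%E).
    by apply: lee_sum => r _; exact: Apr.
  (* The factor [v p] of [q p] cancels, leaving [K * 4 ^ p * (p + 1) / phi (v p)]; the growth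
     condition with [8 ^ p] turns this into at most [K * 2 ^ -p]. *)
  rewrite sumEFin lee_fin sumr_const card_ord -[leLHS]mulr_natl qE !natrM natrX.
  have vk : 0 < (v p)%:R :> R by rewrite ltr0n.
  have phk := phi0 (v p)%:R.
  rewrite [leLHS](_ : _ = K * (4 ^+ p * p.+1%:R / phi (v p)%:R)); last first.
    by field; rewrite !gt_eqF.
  rewrite ler_wpM2l // ler_pdivrMr //.
  apply: le_trans (_ : 2^-1 ^+ p * (p.+1%:R * 8 ^+ p) <= _); last first.
    by rewrite ler_wpM2l // exprn_ge0.
  rewrite mulrCA -exprMn mulrC (_ : 2^-1 * 8 = 4 :> R) //; by field.
apply: filterS (borel_cantelli_geometric mG GK) => x [p0 nG].
exists p0 => p r pp rq; rewrite leNgt; apply/negP => big; apply: (nG p pp).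
rewrite /G -bigcup_mkord; exists r => //=.
have phk := phi0 (v p)%:R.
(* Below [v p] use the trivial bound, above it [phi (v p) <= phi `|f y|]. *)
have gle y : `|f y| <= (v p)%:R + psi y / phi (v p)%:R.
  have [fv|fv] := lerP `|f y| (v p)%:R; first by rewrite (le_trans fv) // lerDl divr_ge0 // ltW.
  apply: (@le_trans _ _ (psi y / phi (v p)%:R)); last by rewrite lerDr.
  by rewrite /psi -mulrA ler_peMr // ler_pdivlMr // mul1r phi_nd // ltW.
rewrite /A /= /a mulrC -ler_pdivlMr // mulr_suml.
have pk : 0 < p.+1%:R :> R by [].
have Bv : (size (B (Q p + r)%N))%:R * (v p)%:R <= (c (Q p + r)%N)%:R / p.+1%:R :> R.
  rewrite ler_pdivlMr // -!natrM ler_nat; apply: leq_trans (Bc p r rq).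
  by rewrite -mulnA [(v p * _)%N]mulnC.
have S1 : \sum_(b <- B (Q p + r)%N) `|f (iter b T x)| <=
  (size (B (Q p + r)%N))%:R * (v p)%:R
  + \sum_(b <- B (Q p + r)%N) psi (iter b T x) / phi (v p)%:R.
  rewrite mulr_natl -[X in _ *+ X]count_predT -iter_addr_0 -big_const_seq -big_split /=.
  exact: ler_sum.
move: big; rewrite [2 / _ * _](_ : _ = (c (Q p + r)%N)%:R / p.+1%:R
  + (c (Q p + r)%N)%:R / p.+1%:R); last by ring.
move=> big; have := lt_le_trans big S1.
by move: Bv; set s := _ * (v p)%:R; set t := _ / p.+1%:R; set w := \sum_(b <- _) _; lra.
Qed.
End BlockSums.

(** * Goodness and sweeping out of the perturbed sequence *)

Lemma eventually_blocks (q : nat -> nat) (Pk : nat -> Prop)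
    (Q := fun p => (\sum_(i < p) q i)%N) : (forall p, (0 < q p)%N) ->
  (exists p0, forall p r, (p0 <= p)%N -> (r < q p)%N -> Pk (Q p + r)%N) ->
  exists K, forall k, (K <= k)%N -> Pk k.
Proof.
move=> q0 [p0 Pp]; exists (Q p0) => k Qk.
have [[p r] /= [rq E]] := block_index q0 k; rewrite E; apply: Pp => //.
rewrite leqNgt; apply/negP => pp.
have := leq_trans (block_index_homo q pp) Qk.
by rewrite E big_ord_recr leq_add2l leqNgt rq.
Qed.

Lemma sum1_count (R : realType) (s : seq nat) (P : pred nat) :
  \sum_(b <- s | P b) (1 : R) = (count P s)%:R.
Proof. by rewrite big_const_seq iter_addr_0. Qed.

Section Perturbation.
Variables (R : realType) (S a : nat -> nat) (E P D : pred nat).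
Variables (phi : R -> R) (v : nat -> nat) (N : nat -> nat) (B : nat -> seq nat).
Let w p := (p.+1 * v p)%N.
Let q p := (4 ^ p * w p)%N.
Let Q p := (\sum_(i < p) q i)%N.
Let c M := count E (iota 0 M).
Hypothesis Sm : {homo S : m n / (m < n)%N}.
Hypothesis SE : forall b, E b <-> exists n, S n = b.
Hypothesis am : {homo a : m n / (m < n)%N}.
Hypothesis aD : forall b, D b <-> exists n, a n = b.
Hypothesis DE : forall b, D b = E b || P b.
Hypothesis PB : forall b, P b <-> exists k, b \in B k.
Hypothesis phi_nd : forall x y, x <= y -> phi x <= phi y.
Hypothesis phi_ge1 : forall x, 1 <= phi x.
Hypothesis v0 : forall p, (0 < v p)%N.
Hypothesis phiv : forall p, p.+1%:R * 8 ^+ p <= phi (v p)%:R.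
Hypothesis uniqB : forall k, uniq (B k).
Hypothesis BN : forall k b, b \in B k -> (N k <= b < 2 * N k)%N.
Hypothesis NP : forall k, [/\ (0 < c (N k))%N, (2 * N k <= N k.+1)%N,
  (2 * N k <= c (N k.+1))%N & (c (2 * N k) <= 4 * c (N k))%N].
Hypothesis BQ : forall p r, (r < q p)%N ->
  [/\ forall b, b \in B (Q p + r)%N -> b = r %[mod q p],
      (size (B (Q p + r)%N) * w p <= c (N (Q p + r)%N))%N &
      (c (N (Q p + r)%N) <= 2 * (w p * size (B (Q p + r)%N)))%N].

Let w0 p : (0 < w p)%N. Proof. by rewrite muln_gt0 v0. Qed.
Let q0 p : (0 < q p)%N. Proof. by rewrite muln_gt0 w0 expn_gt0. Qed.
Let BN1 k b : b \in B k -> (N k <= b)%N. Proof. by move=> /BN /andP[]. Qed.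
Let NP1 k : (0 < N k)%N /\ (2 * N k <= N k.+1)%N.
Proof. by have [ck N2 _ _] := NP k; split=> //; apply: leq_trans ck (count_iota_le _ _). Qed.
Let c0 k : (0 < c (N k))%N. Proof. by have [] := NP k. Qed.
Let NP2 k : (2 * N k <= c (N k.+1))%N. Proof. by have [] := NP k. Qed.

Lemma block_size_le k : (size (B k) <= c (N k))%N.
Proof.
have [[p r] /= [rq ->]] := block_index q0 k.
by have [_ + _] := BQ rq; apply: leq_trans; rewrite leq_pmulr.
Qed.

(** A block of the [p]-th group has at most [c (N k) / w p] terms, and [w p >= p + 1], so
    [block_sum_negligible] applies to the constant [1]. *)
Lemma added_terms_negligible : (fun M => (count P (iota 0 M))%:R / (c M)%:R) @ \oo --> (0 : R).
Proof.
under eq_fun do rewrite -sum1_count.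
apply: (block_sum_negligible _ BN1 NP1 NP2) => [b /PB//|//|lam lam0].
apply: (eventually_blocks q0); exists (Num.truncn lam^-1) => p r pp rq.
have [_ + _] := BQ rq.
rewrite sum1_count count_predT -(ler_nat R) natrM => Bc.
have lamp : lam^-1 <= (w p)%:R.
  apply: le_trans (ltW (truncnS_gt _)) _; rewrite ler_nat.
  by apply: leq_trans (leq_pmulr _ (v0 p)); rewrite ltnS.
rewrite -ler_pdivrMl // mulrC; apply: le_trans Bc.
by rewrite ler_wpM2l.
Qed.

(** Since [phi >= 1], [f] is integrable and its averages along [S] converge; the block sums of [|f|]
    are negligible almost everywhere, so the averages along [a] have the same limit. *)
Lemma perturbed_good : universally_good (@L1_space R) S ->
  universally_good (Lphi_space phi) a.
Proof.
move=> S_good d X m T sysT f ff; have [_ mpT _] := sysT.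
have phi0 x : 0 < phi x by exact: lt_le_trans (phi_ge1 x).
have [mf intf] := ff.
have f1 : L1_space m f.
  apply/integrableP; split; first exact/measurable_EFinP.
  apply: le_lt_trans intf; apply: ge0_le_integral => //.
  - by do 2 apply: measurableT_comp => //.
  - apply/measurable_EFinP; apply: measurable_funM; first exact: measurableT_comp.
    apply: (measurableT_comp (f := phi)); last exact: measurableT_comp.
    exact: nondecreasing_measurable.
  - by move=> x _; rewrite lee_fin ler_peMr.
have blocks := Lphi_block_sums mpT phi_nd phi0 ff (fun p => erefl (q p)) v0 phiv c0
   (fun p r rq => let: And3 _ h _ := BQ rq in h).
move: (S_good _ _ _ _ sysT f f1) blocks; apply: filterS2 => x cS [p0 small].
have /cvg_ex[l Sl] := cS.
apply/cvg_ex; exists l.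
apply: (average_perturbation_cvg (g := fun b => f (iter b T x))
  Sm SE am aD DE Sl _ added_terms_negligible).
apply: (block_sum_negligible _ BN1 NP1 NP2) => [b /PB//|//|lam lam0].
apply: (eventually_blocks q0).
exists (maxn p0 (Num.truncn (2 / lam))) => p r; rewrite geq_max => /andP[pp pl] rq.
apply: le_trans (small p r pp rq) _; rewrite ler_wpM2r //.
rewrite ler_pdivrMr // mulrC -ler_pdivrMr //.
by apply: le_trans (ltW (truncnS_gt _)) _; rewrite ler_nat ltnS.
Qed.

Lemma perturbed_sweeping_out : universally_sweeping_out (@L1_space R) a.
Proof.
move=> d X m T sysT.
pose h p : R := 2 ^+ p * (w p)%:R.
have h0 p : 0 <= h p by rewrite mulr_ge0 // exprn_ge0.
have hC p : h p * (2 / (q p)%:R) <= 2 * 2^-1 ^+ p.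
  rewrite /h /q natrM natrX (_ : 4 = 2 * 2 :> R); last by ring.
  rewrite exprMn le_eqVlt; apply/orP; left; apply/eqP; rewrite exprVn.
  have wn0 : (w p)%:R != 0 :> R by rewrite pnatr_eq0 -lt0n.
  have e0 : 2 ^+ p != 0 :> R by rewrite expf_neq0.
  by field; rewrite wn0 e0.
(* The time bound [2 * N (Q p.+1)] lies beyond every block of the [p]-th group. *)
have [f [f0 f1 aef]] := sweeping_function (fun p => 2 * N (Q p.+1))%N sysT q0 h0 hC.
exists f => //; apply: filterS aef => x [p0 big].
apply/eqyP => A A0.
(* The constant [12] is [6 * 2]: [n <= 6 * c (N k)] and [c (N k) <= 2 * w p * size (B k)], while the
   block alone contributes [size (B k) * 2 ^ p * w p]. *)
pose p := maxn p0 (Num.truncn (12 * A)).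
have [r rq hf] := big p (leq_maxl _ _).
set k := (Q p + r)%N.
have [Bmod Bw wB] := BQ rq; rewrite -/k in Bmod Bw wB.
have Nmono := block_bounds_homo NP1.
have B0 : (0 < size (B k))%N.
  by rewrite lt0n; apply/eqP => B0; have := c0 k; move: wB; rewrite B0 muln0; lia.
have kQ : (k < Q p.+1)%N by rewrite /Q big_ord_recr ltn_add2l.
pose M := (2 * N k)%N; pose n := count D (iota 0 M).
have sub : {subset B k <= [seq b <- iota 0 M | D b]}.
  move=> b bk; rewrite mem_filter mem_iota /= add0n DE.
  have /andP[_ ->] := BN bk; rewrite andbT; apply/orP; right; apply/PB; by exists k.
have fB : (size (B k))%:R * h p <= \sum_(i < n) f (iter (a i) T x).
  rewrite -(sum_increasing_enum (fun b => f (iter b T x)) M am aD) -big_filter.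
  apply: le_trans (ler_sum_subset _ (uniqB k) sub) => //.
  rewrite mulr_natl -[X in _ *+ X]count_predT -iter_addr_0 -big_const_seq.
  rewrite big_seq [leRHS]big_seq; apply: ler_sum => b bk; apply: hf; last exact: Bmod.
  have /andP[_ bM] := BN bk; apply: leq_trans (ltnW bM) _.
  by rewrite leq_mul2l /= ltnW // Nmono.
have nB : (0 < n)%N.
  rewrite /n -size_filter; apply: leq_trans B0 _; exact: uniq_leq_size (uniqB k) sub.
have PM : (count P (iota 0 M) <= 2 * c (N k))%N.
  have [_ N2 _ _] := NP k.
  have g0 b : 0 <= (fun _ : nat => 1 : R) b by [].
  have := block_sum_le (fun b => (PB b).1) BN1 NP1 g0 N2.
  rewrite sum1_count big_ord_recr /= sum1_count count_predT => le1.
  have sz j : (0 <= j)%N -> \sum_(b <- B j) (1 : R) <= 1 * (c (N j))%:R.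
    by move=> _; rewrite sum1_count count_predT mul1r ler_nat block_size_le.
  have := block_sum_geom NP2 ler01 sz (leq0n k).
  rewrite big_ord0 add0r mul1r => le2.
  rewrite -(ler_nat R); apply: le_trans le1 _; rewrite mul2n -addnn natrD.
  by apply: lerD => //; rewrite ler_nat block_size_le.
(* At most [4 * c (N k)] terms come from [S], by the doubling property, and [2 * c (N k)] from the
   blocks. *)
have n6 : (n <= 6 * c (N k))%N.
  have [_ _ _ c4] := NP k.
  have : (n <= c M + count P (iota 0 M))%N.
    rewrite /n (@eq_count _ D (predU E P)); last by move=> b; rewrite DE.
    by have := count_predUI E P (iota 0 M); rewrite /c; lia.
  by move: c4 PM; rewrite -/M; lia.
apply: le_trans (ereal_sup_ubound _); last by exists n => //.
rewrite lee_fin /average -ler_pdivrMl ?invr_gt0 ?ltr0n // invrK.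
apply: le_trans fB.
have Ap : 12 * A <= 2 ^+ p.
  apply: le_trans (ltW (truncnS_gt _)) _; rewrite -natrX ler_nat.
  by apply: leq_ltn_trans (leq_maxr p0 _) _; exact: ltn_expl.
have n6R : n%:R <= 6 * (c (N k))%:R :> R by rewrite -natrM ler_nat.
have wBR : (c (N k))%:R <= 2 * ((w p)%:R * (size (B k))%:R) :> R by rewrite -!natrM ler_nat.
apply: le_trans (ler_wpM2r (ltW A0) n6R) _.
have c0R : 0 <= (c (N k))%:R :> R by [].
have e0 : 0 <= 2 ^+ p :> R by rewrite exprn_ge0.
rewrite /h mulrCA [_%:R * _]mulrC.
apply: (@le_trans _ _ (2^-1 * ((c (N k))%:R * 2 ^+ p))).
  have := ler_wpM2l c0R Ap; lra.
have := ler_wpM2r e0 wBR; lra.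
Qed.

End Perturbation.

(** * Choice of the parameters and conclusion *)

Theorem theorem2 (R : realType) (S : nat -> nat)
    (S_seq : increasing_pos_seq S)
    (S_density : zero_density R (range S))
    (S_good : universally_good (@L1_space R) S)
    (phi : R -> R)
    (phi_pos : forall x : R, 0 < phi x)
    (phi_unbounded : forall M : R, exists x : R, M < `|phi x|)
    (phi_one : forall x : R, x <= 1 -> phi x = 1)
    (phi_incr : forall x y : R, 1 <= x -> x < y -> phi x < phi y) :
  exists Delta : nat -> nat,
    [/\ increasing_pos_seq Delta,
        perturbation R (range Delta) (range S),
        universally_good (Lphi_space phi) Delta &
        universally_sweeping_out (@L1_space R) Delta].
Proof.
have [S0 Sm] := S_seq.
pose E : pred nat := fun b => `[< exists n, S n = b >].
have SE b : E b <-> exists n, S n = b by split => /asboolP.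
have rangeE b : range S b <-> E b.
  by rewrite SE; split => [[n _ <-]|[n <-]]; exists n.
have E0 : ~~ E 0%N.
  apply/negP => /SE[n Sn0].
  by have := ltnW_homo Sm (leq0n n); rewrite Sn0 leqNgt S0.
have phi_nd x y : x <= y -> phi x <= phi y.
  rewrite le_eqVlt => /orP[/eqP -> //|xy].
  have [x1|x1] := lerP 1 x; first exact/ltW/phi_incr.
  rewrite (phi_one x (ltW x1)); have [y1|y1] := lerP y 1; first by rewrite phi_one.
  by rewrite -(phi_one 1 (lexx _)) ltW // phi_incr.
have phi_ge1 x : 1 <= phi x.
  have [x1|x1] := lerP x 1; first by rewrite phi_one.
  by rewrite -(phi_one 1 (lexx _)) phi_nd // ltW.
(* Unboundedness gives a real point where [phi] is large; by monotonicity any larger integer serves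
   as [v p]. *)
have exv p : exists n : nat, (0 < n)%N /\ p.+1%:R * 8 ^+ p <= phi n%:R.
  have [x Mx] := phi_unbounded (p.+1%:R * 8 ^+ p).
  exists (Num.truncn `|x|).+1; split => //.
  apply: le_trans (ltW Mx) _; rewrite ger0_norm ?(ltW (phi_pos _)) //.
  by apply: phi_nd; apply: le_trans (ler_norm _) (ltW (truncnS_gt _)).
have [v vP] := choice exv.
have v0 p : (0 < v p)%N by have [] := vP p.
have phiv p : p.+1%:R * 8 ^+ p <= phi (v p)%:R by have [] := vP p.
have w0 p : (0 < p.+1 * v p)%N by rewrite muln_gt0 v0.
have q0 p : (0 < 4 ^ p * (p.+1 * v p))%N by rewrite muln_gt0 w0 expn_gt0.
have Einf := increasing_enum_unbounded Sm SE.
have [N [B [uniqB BN NP BQ]]] :=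
  exists_blocks q0 w0 Einf (zero_density_count rangeE E0 S_density).
pose P : pred nat := fun b => `[< exists k, b \in B k >].
have PB b : P b <-> exists k, b \in B k by split => /asboolP.
pose D b := E b || P b.
have Dinf n : exists2 m, (n <= m)%N & D m.
  by have [m nm Em] := Einf n; exists m; rewrite // /D Em.
have [a am aD] := exists_increasing_enum Dinf.
have D0 : ~~ D 0%N.
  rewrite /D negb_or E0; apply/negP => /PB[k /BN /andP[Nk _]].
  have [ck _ _ _] := NP k.
  by have := leq_trans ck (leq_trans (count_iota_le _ _) Nk).
have rangeD b : range a b <-> D b.
  by rewrite aD; split => [[n _ <-]|[n <-]]; exists n.
exists a; split.
- split => //; rewrite lt0n; apply: contra D0 => /eqP a0.
  by apply/aD; exists 0%N.
- rewrite /perturbation.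
  (* [D] contains [E], so the symmetric difference reduces to the part of [P] outside [E]. *)
  have symE b : ((range a `\` range S) `|` (range S `\` range a)) b <-> P b && ~~ E b.
    split => [[[/rangeD Db nE]|[/rangeE Eb nD]]|/andP[Pb nE]].
    + have nEb : ~~ E b by apply/negP => /rangeE.
      by move: Db; rewrite /D (negbTE nEb) /= => ->.
    + by exfalso; apply: nD; apply/rangeD; rewrite /D Eb.
    + left; split; first by apply/rangeD; rewrite /D Pb orbT.
      by move/rangeE; apply/negP.
  have PE0 : ~~ (P 0%N && ~~ E 0%N).
    by move: D0; rewrite /D negb_or => /andP[_ /negbTE ->].
  under eq_fun do rewrite (count_belowE _ symE PE0) (count_belowE _ rangeE E0).
  apply: squeeze_cvgr (cvg_cst 0) (added_terms_negligible PB v0 BN NP BQ).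
  apply: nearW => n; rewrite divr_ge0 //= ler_wpM2r ?invr_ge0 // ler_nat.
  by apply: sub_count => b /andP[].
- exact: (perturbed_good Sm SE am aD (fun=> erefl) PB phi_nd phi_ge1 v0 phiv BN NP BQ S_good).
- exact: (perturbed_sweeping_out am aD (fun=> erefl) PB v0 uniqB BN NP BQ).
Qed.
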